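(* Let $W_0 = \{ f \in W^{1,2}[0,1] : f(0)=f(1)=0 \}$. A function $\phi : (0,1) \to \mathbb{C}$ is the symbol of a densely defined multiplier on $W_0$ (that is, $D(M_\phi) = \{ f \in W_0 : \phi f \in W_0\}$ is dense in $W_0$) if and only if $\phi|_{[a,b]} \in W^{1,2}[a,b]$ for every compact interval $[a,b] \subset (0,1)$.
   Context: For a compact interval $[a,b]$, $W^{1,2}[a,b]$ denotes the set of functions $f : [a,b] \to \mathbb{C}$ that are absolutely continuous with $f' \in L^2[a,b]$ (actual functions, not equivalence classes). $W^{1,2}[0,1]$ is a Hilbert space with inner product $\langle f | g\rangle = \int_0^1 f(x)\overline{g(x)} + f'(x)\overline{g'(x)}\, dx$, and $W_0 = \{ f \in W^{1,2}[0,1] : f(0)=f(1)=0 \}$ is a closed subspace carrying the same inner product. Elements of $W_0$ vanish at $0$ and $1$, so $W_0$ is regarded as a Hilbert space of functions on $(0,1)$. For $\phi:(0,1)\to\mathbb{C}$ and $f \in W_0$, ''$\phi f \in W_0$'' means that the function equal to $\phi(x) f(x)$ for $x\in(0,1)$ and to $0$ at $x = 0,1$ belongs to $W_0$. The domain of the multiplication operator $M_\phi f = \phi f$ is $D(M_\phi) = \{ f \in W_0 : \phi f \in W_0 \}$, and $\phi$ is (the symbol of) a densely defined multiplier on $W_0$ if $D(M_\phi)$ is dense in $W_0$ in the norm of $W^{1,2}[0,1]$. *)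

(* Defs.v *)
From HB Require Import structures.
From mathcomp Require Import all_boot all_order all_algebra.
From mathcomp Require Import complex.
From mathcomp Require Import all_classical all_reals all_analysis.

Set Implicit Arguments.
Unset Strict Implicit.
Unset Printing Implicit Defensive.

Import Order.TTheory GRing.Theory Num.Theory.
Import numFieldNormedType.Exports.

Local Open Scope classical_set_scope.
Local Open Scope ring_scope.
Local Open Scope complex_scope.

(* Functions on an interval I are represented by total functions R -> R[i];
   every notion below depends only on the values taken on I.
   Complex-valued functions of a real variable are differentiated, tested for
   measurability and integrated through their real and imaginary parts;
   normc is the modulus, as an element of R. *)

Section Sobolev.
Variable R : realType.
Implicit Types (a b : R) (f g phi : R -> R[i]).

Local Notation mu := (@lebesgue_measure R).
Local Notation Re := (@complex.Re R).
Local Notation Im := (@complex.Im R).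
Local Notation normc := (@Normc.normc R).

Definition abs_continuous a b f : Prop :=
  forall e : R, 0 < e -> exists2 d : R, 0 < d &
    forall (n : nat) (s t : 'I_n -> R),
      (forall i, [/\ a <= s i, s i <= t i & t i <= b]) ->
      trivIset setT (fun i => `]s i, t i[%classic) ->
      \sum_(i < n) (t i - s i) < d ->
      \sum_(i < n) normc (f (t i) - f (s i)) < e.

Definition cderivable f (x : R) : Prop :=
  derivable (Re \o f) x 1 /\ derivable (Im \o f) x 1.

(* Where f is not differentiable this is a junk value. *)
Definition cderive f (x : R) : R[i] :=
  derive1 (Re \o f) x +i* derive1 (Im \o f) x.

Definition cRintegral (D : set R) f : R[i] :=
  Rintegral mu D (Re \o f) +i* Rintegral mu D (Im \o f).

Definition L2 a b : set (R -> R[i]) := [set g : R -> R[i] |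
  [/\ measurable_fun `[a, b] (Re \o g), measurable_fun `[a, b] (Im \o g) &
      (\int[mu]_(x in `[a, b]) (normc (g x) ^+ 2)%:E < +oo)%E]].

(* The derivative is two-sided, so at the end points it may see values of f
   outside [a, b], or not exist; this only concerns a null set. *)
Definition W12 a b : set (R -> R[i]) := [set f : R -> R[i] |
  [/\ abs_continuous a b f,
      {ae mu, forall x, x \in `[a, b] -> cderivable f x} &
      L2 a b (cderive f)]].

Definition W12_dot f g : R[i] :=
  cRintegral `[0, 1]
    (fun x => f x * (g x)^* + cderive f x * (cderive g x)^*).

Definition W12_norm f : R := Num.sqrt (Re (W12_dot f f)).

Definition W0 : set (R -> R[i]) :=
  [set f : R -> R[i] | [/\ W12 0 1 f, f 0 = 0 & f 1 = 0]].

Definition mult phi f : R -> R[i] :=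
  fun x => if x \in `]0, 1[ then phi x * f x else 0.

Definition mult_dom phi : set (R -> R[i]) :=
  [set f : R -> R[i] | W0 f /\ W0 (mult phi f)].

Definition densely_defined_multiplier phi : Prop :=
  forall f, W0 f -> forall e : R, 0 < e ->
    exists2 g, mult_dom phi g & W12_norm (fun x => f x - g x) < e.

End Sobolev.

(* Main.v *)
Require Import Defs.
From mathcomp Require Import all_boot all_order all_algebra.
From mathcomp Require Import complex ring lra.
From mathcomp Require Import all_classical all_reals all_analysis.
From mathcomp Require Import measurable_realfun.

(** Two facts about W0 carry the theorem, one for each direction: a small norm
    forces small values at every point, and every function of W0 is a limit of
    functions of W0 that vanish near the end points.

    Suppose that the domain of the multiplication is dense, and let [a, b] be
    a compact interval in (0, 1).  The function p x = x (1 - x) lies in W0 and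
    is at least 2 e = a (1 - b) on [a, b].  An element g of the domain at
    distance less than e from p satisfies |p - g| <= e on [0, 1]
    ([rW12_bound]), hence Re g >= e on [a, b].  There phi = (phi g) / g is a
    quotient of functions of W12 whose denominator stays away from 0, so it is
    in W12 ([W12_factor]).

    Suppose conversely that phi is locally in W12, and let f be in W0.  For a
    small d > 0, subtract from f on [d, 1 - d] the affine function that agrees
    with f at d and 1 - d, and replace f by 0 elsewhere.  The result g is close
    to f: the error is f itself on two short intervals, and in between an
    affine function with small coefficients ([rW12_truncation]).  Since g
    vanishes near 0 and 1, only the restriction of phi to [d, 1 - d] matters
    for phi g, which is therefore in W0 ([W0_mult]).

    All estimates are made on real functions, in the class [rW12], of which the
    real and the imaginary part of a function of W12 are members ([W12P]).  Its
    closure under sums, products and inverses follows from one principle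
    ([rW12_dominated]): a function whose increments are bounded by those of two
    members of the class has a derivative bounded by theirs.

    The pointwise bound needs a form of the fundamental theorem of calculus for
    absolutely continuous functions.  It is obtained by comparing f with a
    nondecreasing F such that |f'| <= F' almost everywhere: then
    |f b - f a| <= F b - F a ([acont_increment_le]).  For F one takes the
    primitive of an integrable majorant of |f'|, which has the required
    derivative by Lebesgue differentiation.

    Finally, membership in L2 asks that the derivative, given the value 0 where
    it does not exist, be a Borel function.  This holds for every continuous
    function ([measurable_derive1]). *)

Set Implicit Arguments.
Unset Strict Implicit.
Unset Printing Implicit Defensive.

Import Order.TTheory GRing.Theory Num.Theory.
Import numFieldNormedType.Exports.

Local Open Scope classical_set_scope.
Local Open Scope ring_scope.
Local Open Scope complex_scope.

(** * Measurability of the derivative of a continuous function *)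

Section Differentiation.
Variable R : realType.
Implicit Types (u v w : R -> R) (x l : R).

(** Multiplying by |h| turns the limit of the difference quotient, taken over
    h <> 0, into a first-order expansion that also makes sense at h = 0. *)
Lemma derive1_cvgP u x l :
  h^-1 *: (u (h + x) - u x) @[h --> 0^'] --> l <->
  forall e : R, 0 < e -> exists2 d : R, 0 < d &
    forall h : R, `|h| < d -> `|u (x + h) - u x - l * h| <= e * `|h|.
Proof.
split=> [/cvgrPdist_le ul e e0|ul].
  have /nbhs_ballP[d d0 ud] := ul e e0.
  exists d => // h hd; have [->|h0] := eqVneq h 0.
    by rewrite addr0 mulr0 !subrr normr0 mulr0.
  have := ud h; rewrite /ball/= sub0r normrN => /(_ hd h0).
  rewrite distrC -(ler_pM2r (x := `|h|)) ?normr_gt0// -normrM.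
  rewrite mulrBl addrC [_ *: _]mulrC addrC -mulrA mulVf// mulr1.
  by rewrite [h + x]addrC.
apply/cvgrPdist_le => e e0; have [d d0 ud] := ul e e0.
apply/nbhs_ballP; exists d => // h; rewrite /ball/= sub0r normrN => hd h0.
rewrite distrC -(ler_pM2r (x := `|h|)) ?normr_gt0// -normrM.
rewrite mulrBl [_ *: _]mulrC -mulrA mulVf// mulr1 [h + x]addrC.
exact: ud.
Qed.

Lemma derivable_cvgE u x :
  derivable u x 1 = cvg (h^-1 *: (u (h + x) - u x) @[h --> 0^']).
Proof.
rewrite /derivable (_ : (fun h => h^-1 *: (u (h + x) - u x)) =
  (fun h : R => h^-1 *: ((u \o shift x) (h *: 1) - u x)))//.
by apply/funext => h /=; rewrite [h *: 1]mulr1.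
Qed.

Lemma derivable_expansion u x : derivable u x 1 ->
  forall e : R, 0 < e -> exists2 d : R, 0 < d &
    forall h : R, `|h| < d -> `|u (x + h) - u x - derive1 u x * h| <= e * `|h|.
Proof. by rewrite derivable_cvgE => ux; apply/derive1_cvgP. Qed.

(** The difference quotient along the steps 1/(n+1) is cut off where the
    derivative does not exist; [derive1] takes the default value 0 there, so
    the sequence converges at every point. *)
Lemma derive1_quotient_cvg u x :
  ((fun y => n.+1%:R * (u (y + n.+1%:R^-1) - u y)) \_
     [set y | derivable u y 1]) x @[n --> \oo] --> derive1 u x.
Proof.
have [Dx|nDx] := pselect (derivable u x 1); last first.
  rewrite /derive1 dvgP; last by rewrite -derivable_cvgE.
  rewrite (_ : (fun n : nat => _) = cst 0); first exact: cvg_cst.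
  by apply/funext => n; rewrite patchE memNset.
have := Dx; rewrite /= derivable_cvgE => ux.
have hcvg : (fun n : nat => (n.+1%:R^-1 : R)) @ \oo --> (0 : R)^'.
  move=> A A0.
  have An : \forall n \near \oo, @harmonic R n != 0 -> A (@harmonic R n).
    exact: (@cvg_harmonic R (fun y => y != 0 -> A y) A0).
  change (\forall n \near \oo, A (@harmonic R n)).
  by apply: filterS An => n; apply; rewrite lt0r_neq0// harmonic_gt0.
have {}ux : (fun n : nat => (n.+1%:R^-1)^-1 *: (u (n.+1%:R^-1 + x) - u x))
    @ \oo --> derive1 u x := cvg_comp _ _ hcvg ux.
rewrite (_ : (fun n : nat => _) = fun n : nat =>
  (n.+1%:R^-1)^-1 *: (u (n.+1%:R^-1 + x) - u x))//.
apply: funext => n.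
rewrite patchE.
have -> : x \in [set y | derivable u y 1] by rewrite inE; exact: Dx.
by rewrite invrK (addrC x).
Qed.

(** By the Cauchy criterion, u is derivable at x when for all k there is n such
    that two difference quotients at x with steps smaller than 1/(n+1) differ by
    at most 1/(k+1).  For fixed k and n this is a closed condition on x, because
    the quotients depend continuously on x. *)
Lemma measurable_derivable u : continuous (u : R -> R) ->
  measurable [set x | derivable u x 1].
Proof.
move=> cu.
pose q h x : R := h^-1 * (u (x + h) - u x).
have cq h : continuous (q h).
  move=> x; apply: cvgM; first exact: cvg_cst.
  apply: cvgB; last exact: cu.
  apply: (@continuous_comp _ _ _ (fun x => x + h) u); last exact: cu.
  by apply: cvgD; [exact: cvg_id|exact: cvg_cst].
pose A (k n : nat) := \bigcap_(p in [set p : R * R |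
    [/\ p.1 != 0, p.2 != 0, `|p.1| < n.+1%:R^-1 & `|p.2| < n.+1%:R^-1]])
  [set x | `|q p.1 x - q p.2 x| <= k.+1%:R^-1].
have -> : [set x | derivable u x 1] = \bigcap_k \bigcup_n A k n.
  apply/seteqP; split => x /=.
    rewrite derivable_cvgE => /cvgrPdist_le ux k _.
    have /nbhs_ballP[d /= d0 ud] := ux (k.+1%:R^-1 / 2) ltac:(by []).
    have qd h : h != 0 -> `|h| < d -> `|derive1 u x - q h x| <= k.+1%:R^-1 / 2.
      by move=> h0 hd; have := ud h; rewrite /ball/= sub0r normrN /q [x + h]addrC;
        exact.
    pose n := Num.trunc d^-1.
    have nd : n.+1%:R^-1 < d :> R.
      by rewrite invf_plt ?posrE// truncnS_gt.
    exists n => // -[h h'] /= [h0 h'0 hn h'n].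
    rewrite (le_trans (ler_distD (derive1 u x) _ _))// [leRHS]splitr distrC.
    by rewrite lerD ?qd// (lt_trans _ nd).
  move=> Ax; rewrite derivable_cvgE; apply/cauchy_cvgP/cauchy_exP => e e0.
  pose k := Num.trunc e^-1.
  have ke : k.+1%:R^-1 < e :> R by rewrite invf_plt ?posrE// truncnS_gt.
  have [n _ An] := Ax k I.
  exists (q n.+2%:R^-1 x); apply/nbhs_ballP; exists n.+1%:R^-1 => //= h.
  rewrite /ball/= sub0r normrN => hn h0.
  have := An (n.+2%:R^-1, h); rewrite /= /q [x + h]addrC => qn.
  apply: (le_lt_trans _ ke); apply: qn; split => //.
  by rewrite ger0_norm// ltf_pV2 ?posrE// ltr_nat.
apply: bigcap_measurableType => k _; apply: bigcup_measurable => n _.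
apply: closed_measurable; apply: closed_bigI => -[h h'] _ /=.
apply: (@preimage_closed _ _ (fun x => `|q h x - q h' x|) [set y | y <= _]).
  by move=> x _; apply: cvg_norm; apply: cvgB; exact: cq.
exact: closed_le.
Qed.

Lemma measurable_derive1 u : continuous (u : R -> R) -> measurable_fun setT (derive1 u).
Proof.
move=> cu; apply: (measurable_fun_cvg (h := fun n : nat =>
  ((fun y => n.+1%:R * (u (y + n.+1%:R^-1) - u y)) \_ [set y | derivable u y 1])));
  last by move=> x _; exact: derive1_quotient_cvg.
move=> n; apply/measurable_restrict => //.
  exact: measurable_derivable.
rewrite setTI; apply: measurable_funTS; apply: continuous_measurable_fun => x.
  apply: cvgM; first exact: cvg_cst.
  apply: cvgB; last exact: cu.
  apply: (@continuous_comp _ _ _ (fun x => x + _) u); last exact: cu.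
  by apply: cvgD; [exact: cvg_id|exact: cvg_cst].
Qed.

End Differentiation.

(** * Absolutely continuous real functions *)

Section AbsoluteContinuity.
Variable R : realType.
Implicit Types (u v w : R -> R) (a b x : R).

(** The real-valued counterpart of [abs_continuous]. *)
Definition acont a b u : Prop :=
  forall e : R, 0 < e -> exists2 d : R, 0 < d &
    forall (n : nat) (s t : 'I_n -> R),
      (forall i, [/\ a <= s i, s i <= t i & t i <= b]) ->
      trivIset setT (fun i => `]s i, t i[%classic) ->
      \sum_(i < n) (t i - s i) < d ->
      \sum_(i < n) `|u (t i) - u (s i)| < e.

Definition clamp a b x := Num.max a (Num.min b x).

Lemma clamp_ge a b x : a <= clamp a b x.
Proof. by rewrite /clamp le_max lexx. Qed.

Lemma clamp_le a b x : a <= b -> clamp a b x <= b.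
Proof. by move=> ab; rewrite /clamp ge_max ab ge_min lexx. Qed.

Lemma clamp_id a b x : a <= x -> x <= b -> clamp a b x = x.
Proof. by move=> ax xb; rewrite /clamp min_r// max_r. Qed.

Lemma clamp_left a b x : a <= b -> x <= a -> clamp a b x = a.
Proof. by move=> ab xa; rewrite /clamp min_r ?(le_trans xa)// max_l. Qed.

Lemma clamp_right a b x : a <= b -> b <= x -> clamp a b x = b.
Proof. by move=> ab bx; rewrite /clamp min_l// max_r. Qed.

Lemma clamp_mono a b x y : x <= y -> clamp a b x <= clamp a b y.
Proof.
rewrite /clamp /Num.max /Num.min => xy.
by do ![case: ifPn]; rewrite -?leNgt => *; lra.
Qed.

Lemma clamp_dist a b x y : x <= y -> clamp a b y - clamp a b x <= y - x.
Proof.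
rewrite /clamp /Num.max /Num.min => xy.
by do ![case: ifPn]; rewrite -?leNgt => *; lra.
Qed.

(** Clamping does not lengthen intervals and keeps them disjoint.  The lemma
    serves both to restrict u to a smaller interval, where w = u, and to extend
    it by constants to a larger one. *)
Lemma acont_clamp a b c d u w : a <= b -> acont a b u ->
  (forall x, c <= x <= d -> w x = u (clamp a b x)) -> acont c d w.
Proof.
move=> ab uac wu e e0; have [r r0 ur] := uac e e0; exists r => // n s t st tst sr.
rewrite (eq_bigr (fun i => `|u (clamp a b (t i)) - u (clamp a b (s i))|)); last first.
  move=> i _; have [cs si td] := st i.
  by rewrite !wu// ?cs ?td ?(le_trans _ td)// (le_trans cs).
apply: ur.
- move=> i; have [cs si td] := st i.
  by rewrite clamp_ge clamp_le// clamp_mono.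
- move=> i j _ _ [x [/= xi xj]]; apply: tst => //; exists x.
  suff H k : x \in `]clamp a b (s k), clamp a b (t k)[ -> `]s k, t k[%classic x.
    by split; apply: H.
  rewrite /= !in_itv/= /clamp /Num.max /Num.min.
  by do ![case: ifPn]; rewrite -?leNgt => *; apply/andP; split; lra.
- apply: le_lt_trans sr; apply: ler_sum => i _; apply: clamp_dist.
  by have [] := st i.
Qed.

Lemma acont_uniform a b u : acont a b u -> forall e : R, 0 < e ->
  exists2 d : R, 0 < d & forall s t, a <= s <= b -> a <= t <= b ->
    `|t - s| < d -> `|u t - u s| < e.
Proof.
move=> uac e e0; have [d d0 ud] := uac e e0; exists d => // s t.
wlog st : s t / s <= t => [wl|].
  have [/wl//|/ltW ts sab tab] := leP s t.
  by rewrite distrC (distrC (u t)); apply: wl.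
move=> /andP[sa sb] /andP[ta tb]; rewrite ger0_norm ?subr_ge0// => std.
have := ud 1%N (fun=> s) (fun=> t); rewrite !big_ord1; apply => //.
by move=> i j _ _ _; rewrite !ord1.
Qed.

(** Clamping replaces a function that is continuous on a compact interval by a
    function that is continuous everywhere and has the same derivative inside. *)
Lemma acont_clamp_continuous a b u : a <= b -> acont a b u ->
  continuous (u \o clamp a b).
Proof.
move=> ab /acont_uniform uac x; apply/cvgrPdist_lt => e e0.
have [d d0 ud] := uac e e0; apply/nbhs_ballP; exists d => // y /= xyd.
rewrite distrC; apply: ud; rewrite ?clamp_ge ?clamp_le//.
have /orP[xy|yx] := le_total x y.
  rewrite ger0_norm ?subr_ge0 ?clamp_mono// (le_lt_trans (clamp_dist _ _ xy))//.
  by move: xyd; rewrite /ball/= distrC ger0_norm// subr_ge0.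
rewrite distrC ger0_norm ?subr_ge0 ?clamp_mono// (le_lt_trans (clamp_dist _ _ yx))//.
by move: xyd; rewrite /ball/= ger0_norm// subr_ge0.
Qed.

Lemma acont_bounded a b u : a <= b -> acont a b u ->
  exists2 M, 0 < M & forall x, a <= x <= b -> `|u x| <= M.
Proof.
move=> ab /(acont_clamp_continuous ab) cu.
have [|c _ uc] := @EVT_max R (fun x => `|u (clamp a b x)|) a b ab.
  by apply: continuous_subspaceT => x; apply: cvg_norm; exact: cu.
exists (`|u (clamp a b c)| + 1); first by rewrite ltr_wpDl.
move=> x xab; have := uc x; rewrite in_itv/= xab => /(_ isT).
by case/andP: xab => ? ?; rewrite clamp_id// => /le_trans; apply; rewrite lerDl.
Qed.

Lemma acont_dominated a b M u v w : 0 < M -> acont a b u -> acont a b v ->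
  (forall s t, a <= s <= b -> a <= t <= b ->
    `|w t - w s| <= M * (`|u t - u s| + `|v t - v s|)) -> acont a b w.
Proof.
move=> M0 uac vac wuv e e0.
have eM : 0 < e / (M * 2) by rewrite divr_gt0// mulr_gt0.
have [d d0 ud] := uac _ eM; have [d' d'0 vd] := vac _ eM.
exists (Num.min d d'); first by rewrite lt_min d0.
move=> n s t st tst; rewrite lt_min => /andP[sd sd'].
have := ltrD (ud n s t st tst sd) (vd n s t st tst sd').
rewrite -big_split/= -(ltr_pM2l M0) mulr_sumr => wlt.
apply: le_lt_trans (lt_le_trans wlt _); last first.
  by rewrite le_eqVlt; apply/orP; left; apply/eqP; field; rewrite gt_eqF.
apply: ler_sum => i _; have [? ? ?] := st i; apply: wuv; apply/andP; split;
  lra.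
Qed.
End AbsoluteContinuity.

(** * Increments and derivatives of absolutely continuous functions *)

Section IncrementInequality.
Variable R : realType.
Implicit Types (f F : R -> R) (a b x : R).
Local Notation mu := (@lebesgue_measure R).

(** The supremum of the points of [a, b] where P holds satisfies P by the step
    hypothesis, used from the left, and it is b by the same hypothesis, used to
    the right. *)
Lemma interval_induction a b (P : R -> Prop) : a <= b -> P a ->
  (forall x, a <= x <= b -> exists2 d : R, 0 < d & forall y z,
     a <= y <= x -> x <= z <= b -> x - y < d -> z - x < d -> P y -> P z) ->
  P b.
Proof.
move=> ab Pa step; pose S := [set x | a <= x <= b /\ P x].
have Sa : S a by rewrite /S/= lexx.
have ubS : ubound S b by move=> x [/andP[]].
have supS : has_sup S by split; [exists a|exists b].
have aS : a <= sup S by apply: ub_le_sup => //; exists b.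
have Sb : sup S <= b by apply: ge_sup => //; exists a.
have [|d d0 dP] := step (sup S); first by rewrite aS.
have [y [/andP[ay yb] Py] yS] := sup_adherent d0 supS.
have yleS : y <= sup S by apply: ub_le_sup => //; [exists b|split=> //; rewrite ay].
have Pz z : sup S <= z <= b -> z - sup S < d -> P z.
  by move=> Sz zd; apply: (dP y z) => //; [rewrite ay|lra].
have [bS|Sb'] := leP b (sup S).
  by apply: Pz; [rewrite Sb lexx|lra].
pose z := Num.min b (sup S + d / 2).
have zb : z <= b by rewrite /z ge_min lexx.
have zd : z <= sup S + d / 2 by rewrite /z ge_min lexx orbT.
have Sz : sup S < z by rewrite /z lt_min Sb' ltrDl divr_gt0.
suff : z <= sup S by rewrite leNgt Sz.
apply: ub_le_sup; first by exists b.
by split; [rewrite zb andbT; lra|apply: Pz; [rewrite zb andbT ltW|lra]].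
Qed.

Lemma negligible_open_cover (N : set R) (e : R) : mu.-negligible N -> 0 < e ->
  exists U : set R, [/\ open U, N `<=` U & (mu U < e%:E)%E].
Proof.
move=> [A [mA A0' NA]] e0; have A0 : mu A = 0%E := A0'.
have muA : (mu A < +oo)%E by rewrite A0 ltry.
have [U [oU AU Ue]] := lebesgue_regularity_outer mA muA e0.
exists U; split => //; first exact: subset_trans AU.
have mU : measurable U by exact: open_measurable.
rewrite (_ : U = A `|` (U `\` A)); last by rewrite setDUK.
apply: le_lt_trans Ue; apply: le_trans (measureU2 _ _ _) _ => //.
  exact: measurableD.
rewrite -[leRHS]add0e leeD// le_eqVlt; apply/orP; left; exact/eqP.
Qed.

Lemma sum_length_le n (s t : 'I_n -> R) (U : set R) : open U ->
  (forall i, s i <= t i) -> trivIset setT (fun i => `]s i, t i[%classic) ->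
  (forall i, `]s i, t i[%classic `<=` U) ->
  ((\sum_(i < n) (t i - s i))%:E <= mu U)%E.
Proof.
move=> oU st tst stU.
apply: (@le_trans _ _ (mu (\big[setU/set0]_(i < n) `]s i, t i[%classic))).
  rewrite (measure_bigsetU_ord mu)//= -sumEFin lee_sum// => i _.
  rewrite lebesgue_measure_itv/= lte_fin; case: ifPn => [_|]; first by rewrite EFinB.
  by rewrite -leNgt lee_fin subr_le0.
apply: le_measure; rewrite ?inE//.
- by apply: bigsetU_measurable.
- exact: open_measurable.
- apply: (big_ind (fun A => A `<=` U)) => [//|A B AU BU|i _]; last exact: stU.
  by rewrite subUset.
Qed.

(** First-order expansions of f and of F at x, each with an error of at most e / 2
    times the length, are compared on both sides of x. *)
Lemma increment_le_at f F x (e : R) : 0 < e ->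
  derivable f x 1 -> derivable F x 1 -> `|derive1 f x| <= derive1 F x ->
  exists2 d : R, 0 < d & forall y z, y <= x -> x <= z -> x - y < d -> z - x < d ->
    `|f z - f y| <= F z - F y + e * (z - y).
Proof.
move=> e0 fx Fx fF.
have e20 : 0 < e / 2 by rewrite divr_gt0.
have [d d0 fd] := derivable_expansion fx e20.
have [d' d'0 Fd] := derivable_expansion Fx e20.
exists (Num.min d d'); first by rewrite lt_min d0.
move=> y z yx xz; rewrite !lt_min => /andP[yd yd'] /andP[zd zd'].
have {fd Fd} B h : `|h| < d -> `|h| < d' ->
    `|f (x + h) - f x| <= derive1 F x * `|h| + e / 2 * `|h| /\
    `|F (x + h) - F x - derive1 F x * h| <= e / 2 * `|h|.
  move=> /fd fh /Fd Fh; split; last exact: Fh.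
  rewrite -[X in `|X|](subrK (derive1 f x * h)) (le_trans (ler_normD _ _))//.
  by rewrite addrC lerD// normrM ler_wpM2r.
have [||fy Fy] := B (y - x);
  rewrite ?(distrC y x) ?(ger0_norm (x := x - y)) ?subr_ge0//.
have [||fz Fz] := B (z - x); rewrite ?(ger0_norm (x := z - x)) ?subr_ge0//.
move: fy fz Fy Fz; rewrite !(addrC x) !subrK (distrC y x).
rewrite (ger0_norm (x := x - y)) ?(ger0_norm (x := z - x)) ?subr_ge0//.
move=> fy fz /ler_normlP[_ Fy] /ler_normlP[Fz _].
have := ler_distD (f x) (f z) (f y); rewrite (distrC (f x)) => ftri.
by lra.
Qed.

(** Cover the exceptional null set by an open set U of small measure.  Going from
    a to b, the increments of f are controlled near a point outside U by those of
    F plus r times the length, and near a point of U by themselves: the intervals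
    used there are disjoint and contained in U, so by absolute continuity the
    corresponding increments of f add up to less than r. *)
Lemma acont_increment_le a b f F : a <= b -> acont a b f ->
  (forall x y, a <= x -> x <= y -> y <= b -> F x <= F y) ->
  {ae mu, forall x, x \in `]a, b[ ->
    [/\ derivable f x 1, derivable F x 1 & `|derive1 f x| <= derive1 F x]} ->
  `|f b - f a| <= F b - F a.
Proof.
move=> ab fac Fmono good; apply/ler_addgt0Pr => e e0.
pose r := e / (b - a + 1).
have r0 : 0 < r by rewrite divr_gt0// ltr_wpDl// subr_ge0.
have [d d0 fd] := fac r r0.
(* The end points, where nothing is known about derivatives, are exceptional. *)
pose N := ~` [set x | x \in `]a, b[ ->
    [/\ derivable f x 1, derivable F x 1 & `|derive1 f x| <= derive1 F x]]
  `|` [set a] `|` [set b].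
have [|U [oU NU Ud]] := @negligible_open_cover N d _ d0.
  by apply: negligibleU; [apply: negligibleU|]; [exact: good| |];
    apply/negligibleP => //; exact: lebesgue_measure_set1.
(* P x: the increment from a to x is controlled, up to the increments of f over
   finitely many disjoint intervals contained in U. *)
pose P x := exists n (s t : 'I_n -> R),
  [/\ forall i, [/\ a <= s i, s i <= t i & t i <= x],
      trivIset setT (fun i => `]s i, t i[%classic),
      forall i, `]s i, t i[%classic `<=` U &
      `|f x - f a| <= F x - F a + r * (x - a) + \sum_(i < n) `|f (t i) - f (s i)|].
have [n [s [t [st tst stU fab]]]] : P b.
  apply: (@interval_induction a) => //.
    exists 0%N, (fun=> a), (fun=> a); split; [by case|by move=> []|by case|].
    by rewrite big_ord0 !subrr normr0 mulr0 !addr0.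
  move=> x /andP[ax xb]; have [xU|xU] := pselect (U x).
    have /nbhs_ballP[c /= c0 xcU] : nbhs x U by apply: open_nbhs_nbhs; split.
    exists c => // y z /andP[ay yx] /andP[xz zb] yc zc [n [s [t [st tst stU fay]]]].
    (* The interval ]y, z[ is put in front of the family already found. *)
    exists n.+1, (oapp s y \o unlift ord0), (oapp t z \o unlift ord0); split.
    - move=> i /=; case: unliftP => [j|] _ /=; last by split; lra.
      by have [? ? ?] := st j; split; lra.
    - have disj j w : `]s j, t j[%classic w -> `]y, z[%classic w -> False.
        rewrite /= !in_itv/= => /andP[_ wt] /andP[yw _].
        by have [_ _ ty] := st j; lra.
      move=> i j _ _ [w []] /=.
      case: unliftP => [i' ->|->]; case: unliftP => [j' ->|->] //=.
      + by move=> wi wj; congr lift; apply: tst => //; exists w.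
      + by move=> wi wj; case: (disj i' w).
      + by move=> wi wj; case: (disj j' w).
    - move=> i; rewrite /=; case: unliftP => [j|] _ /=; first exact: stU.
      move=> w /=; rewrite in_itv/= => /andP[yw wz]; apply: xcU.
      by rewrite /ball/= ltr_norml; apply/andP; split; lra.
    rewrite big_ord_recl/= unlift_none/=.
    under eq_bigr do rewrite liftK/=.
    have := Fmono y z ay (le_trans yx xz) zb.
    have := ler_distD (f y) (f z) (f a).
    have : r * (y - a) <= r * (z - a) by rewrite ler_wpM2l ?(ltW r0)//; lra.
    lra.
  have [xN|] := pselect (N x); first by have := NU _ xN.
  move=> /not_orP[/not_orP[/contrapT gx /eqP xa] /eqP xb'].
  have [|fx Fx fFx] := gx.
    by rewrite in_itv/= !lt_neqAle ax xb xb' eq_sym xa.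
  have [c c0 xc] := increment_le_at r0 fx Fx fFx.
  exists c => // y z /andP[ay yx] /andP[xz zb] yc zc [n [s [t [st tst stU fay]]]].
  exists n, s, t; split => //.
    by move=> i; have [? ? ?] := st i; split => //; lra.
  have := xc y z yx xz yc zc; have := ler_distD (f y) (f z) (f a); lra.
have sd : \sum_(i < n) (t i - s i) < d.
  rewrite -lte_fin; apply: le_lt_trans Ud; apply: sum_length_le => // i.
  by have [] := st i.
have := fd n s t st tst sd.
rewrite (_ : e = r * (b - a) + r); first lra.
by rewrite /r; field; rewrite gt_eqF// ltr_wpDl// subr_ge0.
Qed.

End IncrementInequality.

(** * Real functions of class W12 *)

Section RealSobolev.
Variable R : realType.
Implicit Types (u v w k : R -> R) (a b c d x : R).
Local Notation mu := (@lebesgue_measure R).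

Lemma aeS (P Q : R -> Prop) : (forall x, P x -> Q x) ->
  {ae mu, forall x, P x} -> {ae mu, forall x, Q x}.
Proof. by move=> PQ; apply: (@filterS _ _ (ae_filter_ringOfSetsType mu)). Qed.

Lemma ae_and (P Q : R -> Prop) : {ae mu, forall x, P x} ->
  {ae mu, forall x, Q x} -> {ae mu, forall x, P x /\ Q x}.
Proof. by move=> aP aQ; apply: (@filterI _ _ (ae_filter_ringOfSetsType mu)). Qed.

(** The conditions on the derivative concern the open interval only, so that they
    depend only on the values of u in [a, b]. *)
Definition rW12 a b u : Prop :=
  [/\ acont a b u,
      {ae mu, forall x, x \in `]a, b[ -> derivable u x 1} &
      mu.-integrable `]a, b[ (fun x => (derive1 u x ^+ 2)%:E)].

Lemma near_eq_oo a b u v x : {in `]a, b[, u =1 v} -> x \in `]a, b[ ->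
  \forall y \near x, u y = v y.
Proof.
by move=> uv xab; apply: filterS (near_in_itvoo xab) => y; exact: uv.
Qed.

Lemma eq_derivable_oo a b u v x : {in `]a, b[, u =1 v} -> x \in `]a, b[ ->
  derivable u x 1 -> derivable v x 1.
Proof. by move=> uv xab; apply: near_eq_derivable; exact: near_eq_oo uv xab. Qed.

Lemma eq_derive1_oo a b u v x : {in `]a, b[, u =1 v} -> x \in `]a, b[ ->
  derive1 u x = derive1 v x.
Proof.
by move=> uv xab; rewrite !derive1E; apply: near_eq_derive; exact: near_eq_oo uv xab.
Qed.

Lemma eq_clamp_oo a b u : {in `]a, b[, u \o clamp a b =1 u}.
Proof.
by move=> x; rewrite in_itv/= => /andP[ax xb]; rewrite clamp_id// ltW.
Qed.

Lemma acont_measurable_derive1 a b u : a <= b -> acont a b u ->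
  measurable_fun `]a, b[ (derive1 u).
Proof.
move=> ab /(acont_clamp_continuous ab)/measurable_derive1 mu'.
apply: (eq_measurable_fun (derive1 (u \o clamp a b))).
  by move=> x; rewrite inE => xab; apply: eq_derive1_oo xab; exact: eq_clamp_oo.
exact: measurable_funTS.
Qed.

Lemma acont_measurable_derive1_sqr a b u : a <= b -> acont a b u ->
  measurable_fun `]a, b[ (fun x => (derive1 u x ^+ 2)%:E).
Proof.
move=> ab uac; apply/measurable_EFinP; apply: measurable_funX.
exact: acont_measurable_derive1.
Qed.

(** Square integrability of the derivative follows from an integrable majorant
    almost everywhere, as its measurability is automatic. *)
Lemma rW12_intro a b u k : a <= b -> acont a b u ->
  mu.-integrable `]a, b[ (EFin \o k) ->
  {ae mu, forall x, x \in `]a, b[ ->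
    derivable u x 1 /\ derive1 u x ^+ 2 <= k x} -> rW12 a b u.
Proof.
move=> ab uac ik uk; split => //; first by apply: aeS uk => x /[apply] -[].
have mk : measurable_fun `]a, b[ (abse \o (EFin \o k)).
  by apply: measurableT_comp => //; exact: measurable_int ik.
apply/integrableP; split; first exact: acont_measurable_derive1_sqr.
have /integrableP[_] := ik; apply: le_lt_trans; apply: ae_ge0_le_integral => //.
- by apply: measurableT_comp => //; exact: acont_measurable_derive1_sqr.
- apply: aeS uk => x /[apply] -[_ ux] /=; rewrite lee_fin.
  by rewrite ger0_norm ?sqr_ge0// (le_trans ux)// ler_norm.
Qed.

Lemma derive1_dominated a b M u v w x : 0 < M -> x \in `]a, b[ ->
  (forall s t, a <= s <= b -> a <= t <= b ->
    `|w t - w s| <= M * (`|u t - u s| + `|v t - v s|)) ->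
  derivable u x 1 -> derivable v x 1 -> derivable w x 1 ->
  `|derive1 w x| <= M * (`|derive1 u x| + `|derive1 v x|).
Proof.
move=> M0 xab wuv ux vx wx; apply/ler_addgt0Pr => e e0.
have e1 : 0 < e / (M * 2 + 1) by rewrite divr_gt0// ltr_wpDl// mulr_ge0// ltW.
have [d d0 ud] := derivable_expansion ux e1.
have [d' d'0 vd] := derivable_expansion vx e1.
have [d'' d''0 wd] := derivable_expansion wx e1.
move: xab; rewrite in_itv/= => /andP[ax xb].
(* A step so small that all three expansions apply, to the right of x. *)
pose h := Num.min (b - x) (Num.min d (Num.min d' d'')) / 2.
have h0 : 0 < h by rewrite divr_gt0// !lt_min d0 d'0 d''0 subr_gt0 xb.
have [hb hd hd' hd''] : [/\ h < b - x, h < d, h < d' & h < d''].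
  have : h < h * 2 by lra.
  by rewrite /h mulfVK// !lt_min => /and4P.
have := ud h; have := vd h; have := wd h; rewrite !(gtr0_norm h0).
move=> /(_ hd'') wh /(_ hd') vh /(_ hd) uh.
have xab : a <= x <= b by rewrite !ltW.
have xhab : a <= x + h <= b.
  apply/andP; split; first by rewrite ler_wpDr ?(ltW h0) ?(ltW ax).
  by rewrite -lerBrDl ltW.
have := wuv x (x + h) xab xhab.
have uh' : `|u (x + h) - u x| <= (`|derive1 u x| + e / (M * 2 + 1)) * h.
  rewrite -[X in `|X|](subrK (derive1 u x * h)) (le_trans (ler_normD _ _))//.
  by rewrite normrM (gtr0_norm h0) mulrDl addrC lerD2l.
have vh' : `|v (x + h) - v x| <= (`|derive1 v x| + e / (M * 2 + 1)) * h.
  rewrite -[X in `|X|](subrK (derive1 v x * h)) (le_trans (ler_normD _ _))//.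
  by rewrite normrM (gtr0_norm h0) mulrDl addrC lerD2l.
have wh' : `|derive1 w x| * h <= `|w (x + h) - w x| + e / (M * 2 + 1) * h.
  rewrite -[in leLHS](gtr0_norm h0) -normrM.
  rewrite -[X in `|X|](subrK (w (x + h) - w x)) (le_trans (ler_normD _ _))//.
  by rewrite addrC lerD2l distrC.
move=> whM; rewrite -(ler_pM2r h0) (le_trans wh')//.
move: whM (ler_wpM2l (ltW M0) (lerD uh' vh')).
set r := e / (M * 2 + 1).
have -> : e = r * (M * 2 + 1).
  by rewrite /r mulfVK// gt_eqF// ltr_wpDl// mulr_ge0// ltW.
by clear; lra.
Qed.

(** Sums, products and inverses are instances: the hypothesis on increments
    gives at once absolute continuity and, in the limit, the bound
    |w'| <= M (|u'| + |v'|), whose square is integrable. *)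
Lemma rW12_dominated a b M u v w : a <= b -> 0 < M ->
  rW12 a b u -> rW12 a b v ->
  (forall s t, a <= s <= b -> a <= t <= b ->
    `|w t - w s| <= M * (`|u t - u s| + `|v t - v s|)) ->
  (forall x, x \in `]a, b[ -> derivable u x 1 -> derivable v x 1 ->
    derivable w x 1) ->
  rW12 a b w.
Proof.
move=> ab M0 [uac ux iu] [vac vx iv] wuv wx.
apply: (@rW12_intro _ _ _
  (fun x => 2 * M ^+ 2 * (derive1 u x ^+ 2 + derive1 v x ^+ 2))) => //.
- exact: (acont_dominated M0 uac vac wuv).
- rewrite (_ : _ \o _ = fun x =>
    (2 * M ^+ 2)%:E * ((derive1 u x ^+ 2)%:E + (derive1 v x ^+ 2)%:E))%E//.
  by apply: integrableZl => //; apply: integrableD.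
- apply: aeS (ae_and ux vx) => x [+ +] xab => /(_ xab) {}ux /(_ xab) {}vx.
  have {}wx := wx x xab ux vx; split => //.
  have := derive1_dominated M0 xab wuv ux vx wx.
  rewrite -(real_normK (num_real (derive1 u x))).
  rewrite -(real_normK (num_real (derive1 v x))).
  rewrite -(real_normK (num_real (derive1 w x))).
  move=> /(lerXn2r 2); rewrite !nnegrE => /(_ (normr_ge0 _)).
  rewrite mulr_ge0 ?(ltW M0)// ?addr_ge0//.
  move=> /(_ isT) /le_trans; apply.
  rewrite exprMn -subr_ge0.
  have := mulr_ge0 (sqr_ge0 M) (sqr_ge0 (`|derive1 u x| - `|derive1 v x|)).
  lra.
Qed.


Lemma rW12_eq a b c d u w : c <= a -> a <= b -> b <= d -> rW12 c d u ->
  (forall x, a <= x <= b -> w x = u x) -> rW12 a b w.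
Proof.
move=> ca ab bd [uac ux iu] wu.
have sub : [set` `]a, b[] `<=` [set` `]c, d[].
  move=> x; rewrite /= !in_itv/= => /andP[ax xb].
  by rewrite (le_lt_trans ca)// (lt_le_trans xb).
have uw : {in `]a, b[, u =1 w}.
  by move=> x; rewrite in_itv/= => /andP[ax xb]; rewrite wu// !ltW.
apply: (@rW12_intro _ _ _ (fun x => derive1 u x ^+ 2)) => //.
- apply: (acont_clamp _ uac); first exact: le_trans (le_trans ca ab) bd.
  move=> x /andP[ax xb]; rewrite wu ?ax// clamp_id//; first exact: le_trans ax.
  exact: le_trans bd.
- exact: integrableS iu.
- apply: aeS ux => x ux xab; have xcd : x \in `]c, d[ by exact: sub.
  split; first exact: eq_derivable_oo uw xab (ux xcd).
  by rewrite -(eq_derive1_oo uw xab).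
Qed.

Lemma ae_neq (p : R) : {ae mu, forall x, x != p}.
Proof.
exists [set p]; split => //; first exact: lebesgue_measure_set1.
by move=> x /= /negP; rewrite negbK => /eqP.
Qed.

Lemma derivable_near_cst (p : R) w x : (\forall y \near x, w y = p) ->
  derivable w x 1 /\ derive1 w x = 0.
Proof.
move=> wp; have pw : {near x, cst p =1 w} by apply: filterS wp => y /= ->.
split; first by apply: near_eq_derivable pw _; exact: derivable_cst.
by rewrite derive1E -(near_eq_derive _ pw) derive_cst.
Qed.

(** The derivative of w is that of u inside ]a, b[ and 0 outside [a, b],
    and the two points a and b are negligible. *)
Lemma rW12_clamp a b c d u w : c <= a -> a <= b -> b <= d -> rW12 a b u ->
  (forall x, c <= x <= d -> w x = u (clamp a b x)) -> rW12 c d w.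
Proof.
move=> ca ab bd [uac ux iu] wu.
have cd : c <= d by exact: le_trans (le_trans ca ab) bd.
apply: (@rW12_intro _ _ _ ((fun x => derive1 u x ^+ 2) \_ `]a, b[)) => //.
- exact: acont_clamp uac wu.
- rewrite -restrict_EFin; apply/integrable_restrict => //=.
  by apply: integrableS iu => //; exact: measurableI.
- apply: aeS (ae_and ux (ae_and (ae_neq a) (ae_neq b))) => x [{}ux [xa xb]] xcd.
  have cxd y : y \in `]c, d[ -> c <= y <= d.
    by rewrite in_itv/= => /andP[cy yd]; rewrite !ltW.
  have [xab|xab] := boolP (x \in `]a, b[).
    have uw : {in `]a, b[, u =1 w}.
      move=> y yab; rewrite wu; first by rewrite -(eq_clamp_oo u yab).
      by move: yab; rewrite in_itv/= => /andP[ay yb]; lra.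
    rewrite patchE mem_set// -(eq_derive1_oo uw xab); split => //.
    exact: eq_derivable_oo uw xab (ux xab).
  have [ltxa|ltax|xa'] := ltgtP x a; last by rewrite xa' eqxx in xa.
    have [|dw ->] := @derivable_near_cst (u a) w x.
      have xca : x \in `]c, a[.
        by move: xcd; rewrite !in_itv/= => /andP[-> _].
      apply: filterS (near_in_itvoo xca) => y; rewrite in_itv/= => /andP[cy ya].
      by rewrite wu ?clamp_left// ?ltW//; lra.
    by split=> //; rewrite expr0n/= /patch; case: ifP => // _; exact: sqr_ge0.
  have xb' : b < x.
    move: xab; rewrite in_itv/= ltax/= -leNgt le_eqVlt eq_sym => /orP[/eqP xb'|//].
    by rewrite xb' eqxx in xb.
  have [|dw ->] := @derivable_near_cst (u b) w x.
    have xbd : x \in `]b, d[.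
      by move: xcd; rewrite !in_itv/= xb' => /andP[_ ->].
    apply: filterS (near_in_itvoo xbd) => y; rewrite in_itv/= => /andP[by_ yd].
    by rewrite wu ?clamp_right// ?ltW//; lra.
  by split=> //; rewrite expr0n/= /patch; case: ifP => // _; exact: sqr_ge0.
Qed.

Lemma integrable_oo_cst a b (p : R) : mu.-integrable `]a, b[ (EFin \o cst p).
Proof.
apply/integrableP; split; first by apply/measurable_EFinP; exact: measurable_cst.
rewrite /= integral_cst//= lebesgue_measure_itv/= lte_fin.
by case: ifP => _; rewrite ?mule0 ?ltry// -EFinB -EFinM ltry.
Qed.

Lemma rW12_cst a b (p : R) : a <= b -> rW12 a b (cst p).
Proof.
move=> ab; apply: (@rW12_intro _ _ _ (cst 0)) => //.
- move=> e e0; exists 1 => // n s t _ _ _.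
  by rewrite big1// => i _; rewrite subrr normr0.
- by rewrite (_ : _ \o _ = cst 0%E)//; exact: integrable0.
- apply: aeW => x _; split; first exact: derivable_cst.
  by rewrite derive1E derive_cst expr0n.
Qed.

Lemma rW12_id a b : a <= b -> rW12 a b id.
Proof.
move=> ab; apply: (@rW12_intro _ _ _ (cst 1)) => //.
- move=> e e0; exists e => // n s t st _; apply: le_lt_trans.
  apply: ler_sum => i _; have [_ sti _] := st i.
  by rewrite /= ger0_norm// subr_ge0.
- exact: integrable_oo_cst.
- apply: aeW => x _; split; first exact: derivable_id.
  by rewrite derive1E derive_id expr1n.
Qed.

Lemma rW12D a b u v : a <= b -> rW12 a b u -> rW12 a b v ->
  rW12 a b (fun x => u x + v x).
Proof.
move=> ab ru rv; apply: (rW12_dominated ab ltr01 ru rv) => [s t _ _|x _ ux vx].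
  rewrite mul1r (_ : _ - _ = (u t - u s) + (v t - v s)); last by ring.
  exact: ler_normD.
exact: derivableD ux vx.
Qed.

Lemma rW12M a b u v : a <= b -> rW12 a b u -> rW12 a b v ->
  rW12 a b (fun x => u x * v x).
Proof.
move=> ab ru rv; have [[uac _ _] [vac _ _]] := (ru, rv).
have [M M0 uM] := acont_bounded ab uac; have [N N0 vN] := acont_bounded ab vac.
apply: (rW12_dominated ab (addr_gt0 M0 N0) ru rv) => [s t sab tab|x _ ux vx].
- rewrite (_ : _ - _ = u t * (v t - v s) + v s * (u t - u s)); last by ring.
  rewrite (le_trans (ler_normD _ _))// !normrM.
  have := ler_wpM2r (normr_ge0 (v t - v s)) (uM t tab).
  have := ler_wpM2r (normr_ge0 (u t - u s)) (vN s sab).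
  have := mulr_ge0 (ltW M0) (normr_ge0 (u t - u s)).
  have := mulr_ge0 (ltW N0) (normr_ge0 (v t - v s)).
  lra.
- exact: derivableM ux vx.
Qed.

Lemma rW12N a b u : a <= b -> rW12 a b u -> rW12 a b (fun x => - u x).
Proof.
move=> ab ru; apply: (rW12_eq (lexx a) ab (lexx b)
  (rW12M ab (rW12_cst (-1) ab) ru)) => x _ /=.
by rewrite mulN1r.
Qed.

Lemma rW12B a b u v : a <= b -> rW12 a b u -> rW12 a b v ->
  rW12 a b (fun x => u x - v x).
Proof. by move=> ab ru rv; apply: rW12D => //; exact: rW12N. Qed.

Lemma rW12V a b m u : a <= b -> 0 < m -> rW12 a b u ->
  (forall x, a <= x <= b -> m <= u x) -> rW12 a b (fun x => (u x)^-1).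
Proof.
move=> ab m0 ru um; have M0 : 0 < m^-1 ^+ 2 by rewrite exprn_gt0// invr_gt0.
apply: (rW12_dominated ab M0 ru ru) => [s t sab tab|x].
- have us := um s sab; have ut := um t tab.
  have us0 := lt_le_trans m0 us; have ut0 := lt_le_trans m0 ut.
  rewrite (_ : _ - _ = (u s)^-1 * (u t)^-1 * (u s - u t)); last first.
    by field; rewrite !gt_eqF.
  rewrite normrM distrC ger0_norm ?mulr_ge0 ?invr_ge0 ?(ltW us0) ?(ltW ut0)//.
  rewrite ler_pM ?mulr_ge0 ?invr_ge0 ?(ltW us0) ?(ltW ut0) ?lerDl//.
  by rewrite expr2 ler_pM ?invr_ge0 ?(ltW us0) ?(ltW ut0)// lef_pV2.
- rewrite in_itv/= => /andP[ax xb] ux _; apply: derivableV; last exact: ux.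
  by rewrite gt_eqF// (lt_le_trans m0)// um// !ltW.
Qed.

End RealSobolev.

(** * Bounds on increments by integrals *)

Lemma Rintegral_setS d (T : measurableType d) (R : realType)
    (m : {measure set T -> \bar R}) (A B : set T) (k : T -> R) :
  measurable A -> measurable B ->
  A `<=` B -> m.-integrable B (EFin \o k) -> (forall x, B x -> 0 <= k x) ->
  \int[m]_(x in A) k x <= \int[m]_(x in B) k x.
Proof.
move=> mA mB AB ik k0; have ikA := integrableS mB mA AB ik.
apply: fine_le; [exact: integrable_fin_num|exact: integrable_fin_num|].
by apply: ge0_subset_integral => //; exact: measurable_int ik.
Qed.


Section PointwiseBound.
Variable R : realType.
Implicit Types (u v w k : R -> R) (a b c d x : R).
Local Notation mu := (@lebesgue_measure R).

(** Compare u with the primitive of k extended by 0.  This primitive is taken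
    from -oo, which makes it nondecreasing on the whole line. *)
Lemma acont_increment_le_integral a b u k : a <= b -> acont a b u ->
  mu.-integrable `]a, b[ (EFin \o k) -> (forall x, 0 <= k x) ->
  {ae mu, forall x, x \in `]a, b[ -> derivable u x 1 /\ `|derive1 u x| <= k x} ->
  `|u b - u a| <= \int[mu]_(x in `]a, b[) k x.
Proof.
move=> ab uac ik k0 uk; pose kk := k \_ `]a, b[.
have ikk : mu.-integrable setT (EFin \o kk).
  by rewrite -restrict_EFin; apply/integrable_restrict => //=; rewrite setTI.
have kk0 x : 0 <= kk x by rewrite /kk /patch; case: ifP.
have ikky y : mu.-integrable `]-oo, y] (EFin \o kk) by exact: integrableS ikk.
pose F y := \int[mu]_(t in `]-oo, y]) kk t.
have dF : {ae mu, forall x, derivable F x 1 /\ derive1 F x = kk x}.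
  by apply: FTC1Ny => //; apply: integrable_locally.
have Fmono x y : x <= y -> F x <= F y.
  move=> xy; apply: Rintegral_setS => // z /=; rewrite !in_itv/= => zx.
  exact: le_trans xy.
have Fa : 0 <= F a by apply: Rintegral_ge0.
have Fb : F b <= \int[mu]_(x in `]a, b[) k x.
  have -> : \int[mu]_(x in `]a, b[) k x = \int[mu]_(x in setT) kk x.
    by rewrite Rintegral_mkcond.
  exact: Rintegral_setS.
apply: le_trans (_ : F b - F a <= _); last by lra.
apply: acont_increment_le => //; first by move=> x y _ xy _; exact: Fmono.
apply: aeS (ae_and uk dF) => x [{}uk [Fx F'x]] xab.
have [ux ukx] := uk xab; split; [exact: ux|exact: Fx|].
by rewrite F'x /kk /patch ifT// inE.
Qed.

(** With |u'| <= (t + u' ^ 2 / t) / 2, the inequality of arithmetic and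
    geometric means takes the place of that of Cauchy and Schwarz; the parameter
    t is left free for later optimization. *)
Lemma rW12_increment_le a b u (t : R) : a <= b -> 0 < t -> rW12 a b u ->
  `|u b - u a| <=
    t / 2 * (b - a) + t^-1 / 2 * \int[mu]_(x in `]a, b[) (derive1 u x ^+ 2).
Proof.
move=> ab t0 [uac ux iu].
have icst : mu.-integrable `]a, b[ (EFin \o cst (t / 2)) by exact: integrable_oo_cst.
have iu' : mu.-integrable `]a, b[ (EFin \o (fun x => t^-1 / 2 * derive1 u x ^+ 2)).
  rewrite (_ : _ \o _ = fun x => ((t^-1 / 2)%:E * (derive1 u x ^+ 2)%:E)%E)//.
  exact: integrableZl.
have mab : fine (mu `]a, b[%classic) = b - a.
  rewrite lebesgue_measure_itv/= lte_fin; case: ltP => //.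
  by move=> ba; rewrite (@le_anti _ _ a b) ?ab ?ba// subrr.
pose k x := t / 2 + t^-1 / 2 * derive1 u x ^+ 2.
have -> : t / 2 * (b - a) + t^-1 / 2 * \int[mu]_(x in `]a, b[) (derive1 u x ^+ 2)
    = \int[mu]_(x in `]a, b[) k x.
  transitivity (\int[mu]_(x in `]a, b[) cst (t / 2) x +
      \int[mu]_(x in `]a, b[) (t^-1 / 2 * derive1 u x ^+ 2)).
    congr (_ + _); last by rewrite RintegralZl.
    rewrite [RHS]Rintegral_cst//; congr (_ * _); exact/esym.
  by symmetry; exact: RintegralD.
apply: acont_increment_le_integral => //.
- rewrite (_ : _ \o _ = fun x => ((cst (t / 2) x)%:E +
    (t^-1 / 2 * derive1 u x ^+ 2)%:E)%E)//.
  exact: integrableD.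
- move=> x; apply: addr_ge0; first by rewrite divr_ge0 ?(ltW t0).
  by apply: mulr_ge0; [rewrite divr_ge0 ?invr_ge0 ?(ltW t0)|exact: sqr_ge0].
- apply: aeS ux => x /[apply] ux; split; first exact: ux.
  rewrite -subr_ge0 /k -(real_normK (num_real (derive1 u x))).
  rewrite (_ : _ - _ = t^-1 / 2 * (t - `|derive1 u x|) ^+ 2).
    by apply: mulr_ge0; [rewrite divr_ge0 ?invr_ge0 ?(ltW t0)|exact: sqr_ge0].
  by field; rewrite gt_eqF.
Qed.

End PointwiseBound.

(** * Pointwise bound and truncation *)

Lemma ae_le_Rintegral d (T : measurableType d) (R : realType)
    (m : {measure set T -> \bar R}) (D : set T) (f g : T -> R) :
  measurable D ->
  m.-integrable D (EFin \o f) -> m.-integrable D (EFin \o g) ->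
  (forall x, 0 <= f x) -> (forall x, 0 <= g x) ->
  {ae m, forall x, D x -> f x <= g x} ->
  \int[m]_(x in D) f x <= \int[m]_(x in D) g x.
Proof.
move=> mD iF ig f0 g0 fg.
apply: fine_le; [exact: integrable_fin_num|exact: integrable_fin_num|].
apply: ae_ge0_le_integral => //.
- by move=> x _; rewrite lee_fin.
- exact: measurable_int iF.
- by move=> x _; rewrite lee_fin.
- exact: measurable_int ig.
Qed.

Section Truncation.
Variable R : realType.
Implicit Types (u v w k : R -> R) (a b c d x : R).
Local Notation mu := (@lebesgue_measure R).

(** Apply [rW12_increment_le] on [0, x] with the same t: both terms are then at
    most t / 2. *)
Lemma rW12_bound u (t : R) : 0 < t -> rW12 0 1 u -> u 0 = 0 ->
  \int[mu]_(x in `]0, 1[) (derive1 u x ^+ 2) <= t ^+ 2 ->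
  forall x, 0 <= x <= 1 -> `|u x| <= t.
Proof.
move=> t0 ru u0 ut x /andP[x0 x1].
have rux : rW12 0 x u by apply: rW12_eq (lexx 0) x0 x1 ru _.
have sub : [set` `]0, x[] `<=` [set` `]0, 1[].
  by move=> y; rewrite /= !in_itv/= => /andP[-> /lt_le_trans]; apply.
have [_ _ iu] := ru.
have ux : \int[mu]_(y in `]0, x[) (derive1 u y ^+ 2) <= t ^+ 2.
  apply: le_trans ut; apply: Rintegral_setS => // y _; exact: sqr_ge0.
have := rW12_increment_le x0 t0 rux; rewrite u0 !subr0 => /le_trans; apply.
have ti : 0 <= t^-1 / 2 by rewrite divr_ge0 ?invr_ge0 ?(ltW t0).
have := ler_wpM2l ti ux.
have -> : t^-1 / 2 * t ^+ 2 = t / 2 by field; rewrite gt_eqF.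
have := ler_wpM2l (_ : 0 <= t / 2) x1; rewrite divr_ge0 ?(ltW t0)// => /(_ isT).
lra.
Qed.

Definition energy_density u x := u x ^+ 2 + derive1 u x ^+ 2.

Definition energy u : R := \int[mu]_(x in `]0, 1[) energy_density u x.

Lemma energy_density_ge0 u x : 0 <= energy_density u x.
Proof. by rewrite addr_ge0 ?sqr_ge0. Qed.

Lemma energy_ge0 u : 0 <= energy u.
Proof. by apply: Rintegral_ge0 => x _; exact: energy_density_ge0. Qed.

Lemma integrable_energy a b u : a <= b -> rW12 a b u ->
  mu.-integrable `]a, b[ (EFin \o energy_density u).
Proof.
move=> ab [uac ux iu].
have [M M0 uM] := acont_bounded ab uac.
have mu2 : measurable_fun `]a, b[ (fun x => (u x ^+ 2)%:E).
  apply/measurable_EFinP; apply: measurable_funX.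
  apply: (eq_measurable_fun (u \o clamp a b)).
    by move=> x; rewrite inE => /(eq_clamp_oo u).
  by apply: measurable_funTS; apply: continuous_measurable_fun;
    exact: acont_clamp_continuous.
rewrite (_ : _ \o _ = fun x => (u x ^+ 2)%:E + (derive1 u x ^+ 2)%:E)%E//.
apply: integrableD => //.
apply: (@le_integrable _ _ _ _ _ _ _ (EFin \o cst (M ^+ 2))) => //;
  last exact: integrable_oo_cst.
move=> x /=; rewrite in_itv/= => /andP[ax xb].
rewrite lee_fin !ger0_norm ?sqr_ge0// -(real_normK (num_real (u x))).
by rewrite lerXn2r// ?nnegrE ?(ltW M0)// uM// !ltW.
Qed.

Lemma derivative_le_energy u : rW12 0 1 u ->
  \int[mu]_(x in `]0, 1[) (derive1 u x ^+ 2) <= energy u.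
Proof.
move=> ru; have [_ _ iu] := ru.
apply: le_Rintegral => //; first exact: integrable_energy.
by move=> x _; rewrite /energy_density lerDr sqr_ge0.
Qed.

Definition line (p q s : R) x := p + (x - q) * s.

Lemma derive1_line p q s x : derive1 (line p q s) x = s.
Proof.
apply/cvg_lim; first exact: Rhausdorff.
apply/derive1_cvgP => e e0; exists 1 => // h _.
rewrite (_ : _ - _ = 0) ?normr0 ?mulr_ge0 ?(ltW e0)//.
by rewrite /line; ring.
Qed.

Lemma rW12_line a b p q s : a <= b -> rW12 a b (line p q s).
Proof.
move=> ab; apply: rW12D => //; first exact: rW12_cst.
apply: rW12M => //; last exact: rW12_cst.
by apply: rW12B => //; [exact: rW12_id|exact: rW12_cst].
Qed.

(** With L the affine function that agrees with u at d and 1 - d, the function v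
    is u - L clamped to [d, 1 - d].  The error u - v is u near the end points, where
    its energy is small by absolute continuity of the integral, and L in between,
    whose coefficients are small because u is small at d and 1 - d. *)
Lemma rW12_truncation u (e : R) : rW12 0 1 u -> u 0 = 0 -> u 1 = 0 -> 0 < e ->
  exists v (d : R), [/\ 0 < d, d < 2^-1, rW12 0 1 v,
    forall x, x <= d \/ 1 - d <= x -> v x = 0 &
    energy (fun y => u y - v y) < e].
Proof.
move=> ru u0 u1 e0.
have [uac _ _] := ru.
(* m bounds u d and u (1 - d); then |L| <= 5 m and |L'| <= 4 m, so that L
   contributes at most 41 m ^ 2 < e / 2 to the energy. *)
pose m := Num.sqrt e / 10.
have m2 : m ^+ 2 = e / 100.
  by rewrite -[in RHS](sqr_sqrtr (ltW e0)) /m; field.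
have m0 : 0 < m by rewrite divr_gt0// sqrtr_gt0.
have [d1 d10 ud1] := acont_uniform uac m0.
pose k := energy_density u \_ `]0, 1[.
have ik : mu.-integrable setT (EFin \o k).
  rewrite -restrict_EFin; apply/integrable_restrict => //=; rewrite setTI.
  exact: integrable_energy.
have e20 : 0 < e / 2 by rewrite divr_gt0.
have [d0 [d00 kd0]] := integral_normr_continuous ik e20.
pose d := Num.min 4^-1 (Num.min (d1 / 2) (d0 / 4)).
have [d4 dd1 dd0] : [/\ d <= 4^-1, d <= d1 / 2 & d <= d0 / 4].
  have : d <= d by [].
  by rewrite {2}/d !le_min => /and3P.
have dgt0 : 0 < d by rewrite /d !lt_min invr_gt0 (divr_gt0 d10)// (divr_gt0 d00)// ltr0n.
have d1' : d <= 1 - d by lra.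
pose s := (u (1 - d) - u d) / (1 - d - d).
pose L := line (u d) d s.
have Ld : L d = u d by rewrite /L /line subrr mul0r addr0.
have L1d : L (1 - d) = u (1 - d).
  rewrite /L /line /s [X in _ + X]mulrC divfK; first by rewrite addrC subrK.
  by apply: lt0r_neq0; lra.
pose v x := u (clamp d (1 - d) x) - L (clamp d (1 - d) x).
have vout x : x <= d \/ 1 - d <= x -> v x = 0.
  case=> [xd|xd]; rewrite /v; first by rewrite clamp_left// Ld subrr.
  by rewrite clamp_right// L1d subrr.
have rv : rW12 0 1 v.
  apply: (@rW12_clamp _ d (1 - d) _ _ (fun x => u x - L x)) => //; try lra.
  apply: rW12B => //; last exact: rW12_line.
  by apply: (rW12_eq (c := 0) (d := 1) _ _ _ ru) => //; lra.
exists v, d; split => //; first by lra.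
rewrite /energy.
set w := fun y => u y - v y.
pose A : set R := `]0, d]%classic `|` `[1 - d, 1[%classic.
have rw : rW12 0 1 w by exact: rW12B.
have ud : `|u d| < m.
  have := ud1 0 d; rewrite u0 !subr0 (ger0_norm (ltW dgt0)); apply; lra.
have u1d : `|u (1 - d)| < m.
  have := ud1 1 (1 - d); rewrite u1 subr0 => /(_ ltac:(lra) ltac:(lra)); apply.
  by rewrite ltr_norml; apply/andP; split; lra.
have sm : `|s| <= 4 * m.
  have s2 : `|s| * (1 - d - d) <= 2 * m.
    rewrite -[X in _ * X]ger0_norm; last lra.
    rewrite -normrM divfK; last by apply: lt0r_neq0; lra.
    by have := ler_normB (u (1 - d)) (u d); lra.
  have : `|s| * 2^-1 <= `|s| * (1 - d - d) by rewrite ler_wpM2l//; lra.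
  lra.
pose p := 41 * m ^+ 2.
have iu := integrable_energy ler01 ru.
have mA : measurable A by apply: measurableU.
have iuA : mu.-integrable `]0, 1[ (EFin \o (energy_density u \_ A)).
  rewrite -restrict_EFin; apply/integrable_restrict => //=.
  by apply: integrableS iu => //; exact: measurableI.
have icst : mu.-integrable `]0, 1[ (EFin \o cst p) by exact: integrable_oo_cst.
have smallA : \int[mu]_(x in `]0, 1[) (energy_density u \_ A) x < e / 2.
  have muA : (mu (A `&` `]0%R, 1%R[%classic) < d0%:E)%E.
    apply: (@le_lt_trans _ _ (mu A)).
      by apply: le_measure; rewrite ?inE//; exact: measurableI.
    apply: (@le_lt_trans _ _ (mu `]0%R, d]%classic + mu `[(1 - d)%R, 1%R[%classic)%E).
      exact: measureU2.
    rewrite !lebesgue_measure_itv/= !lte_fin dgt0 (_ : 1 - d < 1); last by lra.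
    by rewrite -!EFinB -EFinD lte_fin; lra.
  rewrite -Rintegral_mkcondl; apply: le_lt_trans (kd0 _ _ muA); last first.
    exact: measurableI.
  rewrite le_eqVlt; apply/orP; left; apply/eqP; apply: eq_Rintegral => x.
  rewrite inE => -[_ x01]; rewrite /k /patch ifT ?inE//.
  by rewrite ger0_norm// energy_density_ge0.
have small_cst : \int[mu]_(x in `]0, 1[) cst p x = p.
  have mu01 : fine (mu `]0%R, 1%R[%classic) = 1.
    by rewrite lebesgue_measure_itv/= lte_fin ltr01/= oppr0 addr0.
  by rewrite [LHS]Rintegral_cst// -[RHS]mulr1 -[in RHS]mu01.
apply: (@le_lt_trans _ _ (\int[mu]_(x in `]0, 1[) (energy_density u \_ A) x +
    \int[mu]_(x in `]0, 1[) cst p x)); last first.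
  by rewrite small_cst /p m2; lra.
rewrite -RintegralD//.
have p0 : 0 <= p by rewrite mulr_ge0// sqr_ge0.
have uA0 x : 0 <= (energy_density u \_ A) x.
  by rewrite /patch; case: ifP => // _; exact: energy_density_ge0.
apply: ae_le_Rintegral => //.
- exact: integrable_energy.
- rewrite (_ : _ \o _ = fun x => ((energy_density u \_ A) x)%:E + (cst p x)%:E)%E//.
  exact: integrableD.
- exact: energy_density_ge0.
- by move=> x; rewrite addr_ge0.
apply: aeS (ae_and (ae_neq d) (ae_neq (1 - d))) => x [xd xd'] /=.
rewrite in_itv/= => /andP[x0 x1].
have outer : (x \in `]0, d[) || (x \in `]1 - d, 1[) ->
    energy_density w x <= (energy_density u \_ A) x.
  move=> xA; have -> : (energy_density u \_ A) x = energy_density u x.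
    rewrite /patch ifT// inE /A /= !in_itv/=.
    by case/orP: xA; rewrite in_itv/= => /andP[y0 y1]; [left|right]; lra.
  have wu y : (y \in `]0, d[) || (y \in `]1 - d, 1[) -> w y = u y.
    move=> yA; rewrite /w vout ?subr0//.
    by case/orP: yA; rewrite in_itv/= => /andP[y0 y1]; [left|right]; lra.
  rewrite /energy_density wu//; case/orP: xA => xA.
    by rewrite (@eq_derive1_oo _ 0 d w u)// => y yA; rewrite wu// yA.
  by rewrite (@eq_derive1_oo _ (1 - d) 1 w u)// => y yA; rewrite wu// yA orbT.
have [xd1|xd1|/eqP] := ltgtP x d; last by rewrite (negbTE xd).
  rewrite (le_trans (outer _)) ?lerDl//.
  by rewrite !in_itv/= x0 xd1.
have [xd2|xd2|/eqP] := ltgtP x (1 - d); last by rewrite (negbTE xd').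
  have xm : x \in `]d, 1 - d[ by rewrite in_itv/= xd1.
  have wL : {in `]d, 1 - d[, w =1 L}.
    move=> y; rewrite in_itv/= => /andP[dy y1d].
    by rewrite /w /v clamp_id ?ltW// opprB addrC subrK.
  rewrite (le_trans (_ : _ <= p)) ?lerDr//.
  rewrite /energy_density wL// (eq_derive1_oo wL xm) derive1_line.
  have Lm : `|L x| <= 5 * m.
    rewrite /L /line (le_trans (ler_normD _ _))// normrM.
    have : `|x - d| * `|s| <= 1 * (4 * m).
      by rewrite ler_pM// ger0_norm; lra.
    lra.
  have L2 : L x ^+ 2 <= (5 * m) ^+ 2.
    rewrite -(real_normK (num_real (L x))) lerXn2r ?nnegrE//.
    by rewrite mulr_ge0// ltW.
  have s2 : s ^+ 2 <= (4 * m) ^+ 2.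
    rewrite -(real_normK (num_real s)) lerXn2r ?nnegrE//.
    by rewrite mulr_ge0// ltW.
  by move: L2 s2; rewrite /p !exprMn; lra.
rewrite (le_trans (outer _)) ?lerDl//.
by rewrite !in_itv/= xd2 x1 orbT.
Qed.

End Truncation.

(** * Complex functions and multipliers *)

Section ComplexSobolev.
Variable R : realType.
Implicit Types (f g phi : R -> R[i]) (a b c d x : R).
Local Notation mu := (@lebesgue_measure R).
Local Notation Re := (@complex.Re R).
Local Notation Im := (@complex.Im R).
Local Notation normc := (@Normc.normc R).

Lemma normc_sqr (z : R[i]) : normc z ^+ 2 = Re z ^+ 2 + Im z ^+ 2.
Proof. by case: z => x y /=; rewrite sqr_sqrtr// addr_ge0 ?sqr_ge0. Qed.

Lemma normc_nneg (z : R[i]) : 0 <= normc z.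
Proof. by case: z => x y /=; rewrite sqrtr_ge0. Qed.

Lemma normr_Re_le (z : R[i]) : `|Re z| <= normc z.
Proof.
rewrite -(ler_pXn2r (ltn0Sn 1)) ?nnegrE ?normc_nneg// normc_sqr.
by rewrite real_normK ?num_real// lerDl sqr_ge0.
Qed.

Lemma normr_Im_le (z : R[i]) : `|Im z| <= normc z.
Proof.
rewrite -(ler_pXn2r (ltn0Sn 1)) ?nnegrE ?normc_nneg// normc_sqr.
by rewrite real_normK ?num_real// lerDr sqr_ge0.
Qed.

Lemma normc_le (z : R[i]) : normc z <= `|Re z| + `|Im z|.
Proof.
rewrite -(ler_pXn2r (ltn0Sn 1)) ?nnegrE ?normc_nneg ?addr_ge0// normc_sqr.
rewrite sqrrD !real_normK ?num_real// -addrA lerD2l lerDr.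
by rewrite mulrn_wge0// mulr_ge0.
Qed.

Lemma ReB (z w : R[i]) : Re (z - w) = Re z - Re w.
Proof. by case: z w => ? ? []. Qed.

Lemma ImB (z w : R[i]) : Im (z - w) = Im z - Im w.
Proof. by case: z w => ? ? []. Qed.

Lemma abs_continuousP a b f :
  abs_continuous a b f <-> acont a b (Re \o f) /\ acont a b (Im \o f).
Proof.
split=> [fac|[uac vac] e e0].
  split=> e e0; have [d d0 fd] := fac e e0; exists d => // n s t st tst sd;
    apply: le_lt_trans (fd n s t st tst sd); apply: ler_sum => i _ /=.
    by rewrite -ReB normr_Re_le.
  by rewrite -ImB normr_Im_le.
have e20 : 0 < e / 2 by rewrite divr_gt0.
have [d d0 ud] := uac _ e20; have [d' d'0 vd] := vac _ e20.
exists (Num.min d d'); first by rewrite lt_min d0.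
move=> n s t st tst; rewrite lt_min => /andP[sd sd'].
have := ltrD (ud n s t st tst sd) (vd n s t st tst sd').
rewrite -splitr -big_split/=; apply: le_lt_trans; apply: ler_sum => i _.
by rewrite -ReB -ImB normc_le.
Qed.

(** The end points, where the two-sided derivative may depend on values outside
    [a, b], form a null set. *)
Lemma W12P a b f : a <= b ->
  W12 a b f <-> rW12 a b (Re \o f) /\ rW12 a b (Im \o f).
Proof.
move=> ab; split=> [[/abs_continuousP[uac vac] df [mu' mv' L2f]]|].
  have sub : [set` `]a, b[] `<=` [set` `[a, b]].
    by move=> x; rewrite /= !in_itv/= => /andP[ax xb]; rewrite !ltW.
  have mn : measurable_fun `[a, b] (fun x => (normc (cderive f x) ^+ 2)%:E).
    apply/measurable_EFinP.
    rewrite (_ : (fun x => _) = fun x =>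
      (Re \o cderive f) x ^+ 2 + (Im \o cderive f) x ^+ 2).
      by apply: measurable_funD; apply: measurable_funX.
    by apply/funext => x; rewrite normc_sqr.
  have iw w : acont a b w ->
      (forall x, derive1 w x ^+ 2 <= normc (cderive f x) ^+ 2) ->
      mu.-integrable `]a, b[ (fun x => (derive1 w x ^+ 2)%:E).
    move=> wac wf; apply/integrableP; split.
      exact: acont_measurable_derive1_sqr.
    apply: le_lt_trans L2f.
    apply: (@le_trans _ _
        (\int[mu]_(x in `]a, b[) (normc (cderive f x) ^+ 2)%:E)%E).
      apply: ge0_le_integral => //.
      - apply: measurableT_comp => //; exact: acont_measurable_derive1_sqr.
      - exact: measurable_funS mn.
      - by move=> x _ /=; rewrite lee_fin ger0_norm ?sqr_ge0.
    by apply: ge0_subset_integral => // x _; rewrite lee_fin sqr_ge0.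
  split; split => //.
  - apply: aeS df => x df xab; have [] := df _ => //.
    exact: (sub x).
  - by apply: iw => // x; rewrite normc_sqr lerDl sqr_ge0.
  - apply: aeS df => x df xab; have [] := df _ => //.
    exact: (sub x).
  - by apply: iw => // x; rewrite normc_sqr lerDr sqr_ge0.
move=> [[uac ux iu] [vac vx iv]]; split.
- exact/abs_continuousP.
- apply: aeS (ae_and (ae_and ux vx) (ae_and (ae_neq a) (ae_neq b))).
  move=> x [[{}ux {}vx] [xa xb]]; rewrite in_itv/= !le_eqVlt eq_sym.
  rewrite (negbTE xa) (negbTE xb)/= => /andP[ax bx].
  by split; [apply: ux|apply: vx]; rewrite in_itv/= ax.
- have mu' := acont_measurable_derive1 ab uac.
  have mv' := acont_measurable_derive1 ab vac.
  split.
  + exact: measurable_fun_itv_cc mu'.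
  + exact: measurable_fun_itv_cc mv'.
  + have E : (fun x => (normc (cderive f x) ^+ 2)%:E) = fun x =>
        ((derive1 (Re \o f) x ^+ 2)%:E + (derive1 (Im \o f) x ^+ 2)%:E)%E.
      by apply/funext => x; rewrite normc_sqr.
    rewrite integral_itv_bndoo E.
      have : mu.-integrable `]a, b[ (fun x => (derive1 (Re \o f) x ^+ 2)%:E +
          (derive1 (Im \o f) x ^+ 2)%:E)%E by exact: integrableD.
      move=> /integrableP[_].
      by under eq_integral do rewrite gee0_abs ?adde_ge0 ?lee_fin ?sqr_ge0//.
    by apply: emeasurable_funD; exact: acont_measurable_derive1_sqr.
Qed.

Lemma W12_norm_energy f (u v : R -> R) : rW12 0 1 u -> rW12 0 1 v ->
  Re \o f =1 u -> Im \o f =1 v ->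
  W12_norm f ^+ 2 = energy u + energy v.
Proof.
move=> + + /funext fu /funext fv; rewrite -fu -fv => ru rv.
have iu := integrable_energy ler01 ru; have iv := integrable_energy ler01 rv.
have -> : W12_norm f = Num.sqrt (\int[mu]_(x in `]0, 1[)
    (energy_density (Re \o f) x + energy_density (Im \o f) x)).
  rewrite /W12_norm /W12_dot /cRintegral /=; congr Num.sqrt.
  rewrite (_ : _ \o _ = fun x =>
    energy_density (Re \o f) x + energy_density (Im \o f) x); last first.
    apply/funext => x; rewrite /energy_density /cderive /=.
    by case: (f x) => p q /=; ring.
  rewrite /Rintegral integral_itv_bndoo//.
  apply/measurable_EFinP; apply: measurable_funD; apply/measurable_EFinP.
    by case/integrableP: iu.
  by case/integrableP: iv.
by rewrite RintegralD// sqr_sqrtr// addr_ge0 ?energy_ge0.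
Qed.

Lemma W0P f : W0 f <-> [/\ rW12 0 1 (Re \o f), rW12 0 1 (Im \o f), f 0 = 0 & f 1 = 0].
Proof.
split=> [[/(W12P _ ler01)[? ?] ? ?]//|[? ? ? ?]].
by split => //; apply/(W12P _ ler01).
Qed.

Lemma W12_subitv a b c d f : c <= a -> a <= b -> b <= d ->
  W12 c d f -> W12 a b f.
Proof.
move=> ca ab bd /(W12P _ (le_trans ca (le_trans ab bd)))[ru rv].
by apply/(W12P _ ab); split; [apply: (rW12_eq ca ab bd ru)|
  apply: (rW12_eq ca ab bd rv)].
Qed.

Lemma mult_in phi f x : 0 < x < 1 -> mult phi f x = phi x * f x.
Proof. by move=> x01; rewrite /mult in_itv/= x01. Qed.

Lemma mult_out phi f x : ~~ (0 < x < 1) -> mult phi f x = 0.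
Proof. by move=> x01; rewrite /mult in_itv/= (negbTE x01). Qed.

Lemma ReM (z w : R[i]) : Re (z * w) = Re z * Re w - Im z * Im w.
Proof. by case: z w => ? ? []. Qed.

Lemma ImM (z w : R[i]) : Im (z * w) = Re z * Im w + Im z * Re w.
Proof. by case: z w => ? ? []. Qed.

(** Where g vanishes, so does the product, whatever the values of phi; in
    particular phi is only evaluated in [a, 1 - a]. *)
Lemma mult_clamp phi g a x : 0 < a -> a <= 1 - a ->
  (forall y, y <= a \/ 1 - a <= y -> g y = 0) ->
  mult phi g x = phi (clamp a (1 - a) x) * g (clamp a (1 - a) x).
Proof.
move=> a0 ab g0; have [xa|ax] := leP x a.
  rewrite clamp_left// [g a]g0 ?mulr0; last by left.
  have [x01|/mult_out//] := boolP (0 < x < 1).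
  by rewrite mult_in// g0 ?mulr0//; left.
have [ax'|xa'] := leP (1 - a) x.
  rewrite clamp_right// [g (1 - a)]g0 ?mulr0; last by right.
  have [x01|/mult_out//] := boolP (0 < x < 1).
  by rewrite mult_in// g0 ?mulr0//; right.
rewrite clamp_id ?(ltW ax) ?(ltW xa')// mult_in//.
by rewrite (lt_trans a0)// (lt_trans xa')// ltrBlDr ltrDl.
Qed.

Lemma W0_mult phi g a : 0 < a -> a <= 1 - a -> W12 a (1 - a) phi -> W0 g ->
  (forall y, y <= a \/ 1 - a <= y -> g y = 0) -> W0 (mult phi g).
Proof.
move=> a0 ab /(W12P _ ab)[rp rq] [W12g _ _] g0.
have a1 : 1 - a <= 1 by rewrite lerBlDr lerDl ltW.
have /(W12P _ ab)[ru rv] := W12_subitv (ltW a0) ab a1 W12g.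
apply/W0P; split.
- apply: (rW12_clamp (ltW a0) ab a1 (rW12B ab (rW12M ab rp ru) (rW12M ab rq rv))).
  by move=> x _; rewrite /= (mult_clamp _ _ a0 ab)// ReM.
- apply: (rW12_clamp (ltW a0) ab a1 (rW12D ab (rW12M ab rp rv) (rW12M ab rq ru))).
  by move=> x _; rewrite /= (mult_clamp _ _ a0 ab)// ImM.
- by rewrite mult_out// ltxx.
- by rewrite mult_out// ltxx andbF.
Qed.

(** The real and imaginary parts of phi = h / g are those of h multiplied by the
    conjugate of g, divided by |g|^2 >= e^2. *)
Lemma W12_factor phi g h a b (e : R) : a <= b -> 0 < e ->
  W12 a b g -> W12 a b h -> (forall x, a <= x <= b -> e <= Re (g x)) ->
  (forall x, a <= x <= b -> h x = phi x * g x) -> W12 a b phi.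
Proof.
move=> ab e0 /(W12P _ ab)[ru rv] /(W12P _ ab)[rs rt] ge hE.
pose N x := (Re \o g) x * (Re \o g) x + (Im \o g) x * (Im \o g) x.
have Ne x : a <= x <= b -> e ^+ 2 <= N x.
  move=> /ge gx; rewrite /N -!expr2 ler_wpDr ?sqr_ge0// lerXn2r ?nnegrE ?(ltW e0)//.
  by rewrite (le_trans (ltW e0)).
have N0 x : a <= x <= b -> N x != 0.
  by move=> /Ne Nx; rewrite gt_eqF// (lt_le_trans _ Nx)// exprn_gt0.
have rN := rW12V ab (exprn_gt0 2 e0) (rW12D ab (rW12M ab ru ru) (rW12M ab rv rv)) Ne.
apply/(W12P _ ab); split.
- apply: (rW12_eq (lexx a) ab (lexx b)
    (rW12M ab (rW12D ab (rW12M ab rs ru) (rW12M ab rt rv)) rN)) => x xab /=.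
  rewrite hE// ReM ImM.
  by have := N0 x xab; rewrite /N /= => Nx; field.
- apply: (rW12_eq (lexx a) ab (lexx b)
    (rW12M ab (rW12B ab (rW12M ab rt ru) (rW12M ab rs rv)) rN)) => x xab /=.
  rewrite hE// ReM ImM.
  by have := N0 x xab; rewrite /N /= => Nx; field.
Qed.

Lemma multiplier_of_local_W12 phi :
  (forall a b, 0 < a -> a <= b -> b < 1 -> W12 a b phi) ->
  densely_defined_multiplier phi.
Proof.
move=> locphi f /W0P[ru rv f0 f1] e e0.
have e20 : 0 < e ^+ 2 / 2 by rewrite divr_gt0 ?exprn_gt0.
have [Rf0 Rf1] : (Re \o f) 0 = 0 /\ (Re \o f) 1 = 0 by rewrite /= f0 f1.
have [If0 If1] : (Im \o f) 0 = 0 /\ (Im \o f) 1 = 0 by rewrite /= f0 f1.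
have [u [c [c0 c2 ru' u0 fu]]] := rW12_truncation ru Rf0 Rf1 e20.
have [v [d [d0 d2 rv' v0 fv]]] := rW12_truncation rv If0 If1 e20.
pose g x := u x +i* v x.
have [a [a0 ac ad a2]] : exists a, [/\ 0 < a, a <= c, a <= d & a < 2^-1].
  exists (Num.min c d).
  by rewrite lt_min !ge_min gt_min c0 d0 c2 !lexx orbT.
have ab : a <= 1 - a by move: a2; clear; lra.
have g0 x : x <= a \/ 1 - a <= x -> g x = 0.
  move=> xa; rewrite /g u0 ?v0//; case: xa => xa; [left|right|left|right].
  - exact: le_trans ad.
  - by apply: le_trans xa; rewrite lerD2l lerN2.
  - exact: le_trans ac.
  - by apply: le_trans xa; rewrite lerD2l lerN2.
have W0g : W0 g.
  apply/W0P; split; [exact: ru'|exact: rv'|apply: g0; left|apply: g0; right].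
    exact: ltW.
  by rewrite lerBlDr lerDl ltW.
exists g; first split; first exact: W0g.
  apply: (W0_mult a0 ab _ W0g g0); apply: locphi => //.
  by rewrite ltrBlDr ltrDl.
rewrite -(ltr_pXn2r (ltn0Sn 1)) ?nnegrE ?sqrtr_ge0 ?(ltW e0)//.
rewrite (W12_norm_energy (rW12B ler01 ru ru') (rW12B ler01 rv rv')).
- rewrite [ltRHS]splitr; exact: ltrD fu fv.
- by move=> x; rewrite /= ReB.
- by move=> x; rewrite /= ImB.
Qed.

Lemma local_W12_of_multiplier phi : densely_defined_multiplier phi ->
  forall a b, 0 < a -> a <= b -> b < 1 -> W12 a b phi.
Proof.
move=> dphi a b a0 ab b1.
pose p x : R := x * (1 - x).
pose e := a * (1 - b) / 2.
have e0 : 0 < e by rewrite divr_gt0// mulr_gt0// subr_gt0.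
have rp : rW12 0 1 p.
  apply: rW12M => //; first exact: rW12_id.
  by apply: rW12B => //; [exact: rW12_cst|exact: rW12_id].
have [] := dphi (fun x => p x +i* 0) _ e e0.
  apply/W0P; split => //; first exact: rW12_cst.
    by rewrite /p mul0r.
  by rewrite /p subrr mulr0.
move=> g [W0g [W12h _ _]] pg.
have [W12g _ _] := W0g; have /W0P[ru rv g0 _] := W0g.
have rpu : rW12 0 1 (fun y => p y - (Re \o g) y).
  exact: rW12B ler01 rp ru.
have r0v : rW12 0 1 (fun y => cst 0 y - (Im \o g) y).
  exact: rW12B ler01 (rW12_cst _ ler01) rv.
have pu x : 0 <= x <= 1 -> `|p x - Re (g x)| <= e.
  apply: (rW12_bound e0 rpu); first by rewrite /p/= g0 mul0r subrr.
  apply: (@le_trans _ _ (W12_norm (fun x => p x +i* 0 - g x) ^+ 2)); last first.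
    by rewrite lerXn2r ?nnegrE ?sqrtr_ge0 ?ltW.
  rewrite (W12_norm_energy rpu r0v).
  - apply: le_trans (derivative_le_energy rpu) _; rewrite lerDl.
    exact: energy_ge0.
  - by move=> y; rewrite /= ReB.
  - by move=> y; rewrite /= ImB.
have ge x : a <= x <= b -> e <= Re (g x).
  move=> /andP[ax xb].
  have : p x - Re (g x) <= e by rewrite (le_trans (ler_norm _))// pu//; lra.
  have : a * (1 - b) <= p x by rewrite ler_pM//; lra.
  by rewrite /e; lra.
apply: (W12_factor ab e0 _ _ ge).
- exact: W12_subitv (ltW a0) ab (ltW b1) W12g.
- exact: W12_subitv (ltW a0) ab (ltW b1) W12h.
- by move=> x /andP[ax xb]; rewrite mult_in// (lt_le_trans a0)// (le_lt_trans xb).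
Qed.

End ComplexSobolev.

Theorem theorem2p1 (R : realType) (phi : R -> R[i]) :
  densely_defined_multiplier phi <->
  (forall a b : R, 0 < a -> a <= b -> b < 1 -> W12 a b phi).
Proof.
split; first exact: local_W12_of_multiplier.
exact: multiplier_of_local_W12.
Qed.
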